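(* There is an absolute constant $c>0$ such that for all integers $n\ge k\ge 1$ and every integer $m\ge (cn/k)^c$, there exists a $k\times n$ matrix with integer entries in $\{-m,\ldots,m\}$ which is an MDS matrix, i.e. every $k\times k$ submatrix formed by choosing $k$ of its columns is nonsingular (over $\mathbb{R}$).
   Context: A $k\times n$ matrix ($n\ge k$) is called an MDS matrix if any $k$ of its columns are linearly independent, equivalently every $k\times k$ minor is nonzero. $c$ does not depend on $n,k,m$. *)

(* Defs.v *)
From Stdlib Require Import Reals.
From mathcomp Require Import all_boot all_algebra.
Set Implicit Arguments. Unset Strict Implicit. Unset Printing Implicit Defensive.
Import GRing.Theory Num.Theory.
Local Open Scope ring_scope.

(* A k x n integer matrix is MDS if every k x k submatrix obtained by choosing
   k distinct columns (f injective, columns taken in the order given by f)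
   has nonzero determinant. Nonsingularity over R of an integer matrix is
   equivalent to nonzero integer determinant (det commutes with the ring
   embedding Z -> R); we map to rat, a subfield of R, for definiteness. *)
Definition MDS (k n : nat) (A : 'M[int]_(k, n)) : Prop :=
  forall f : 'I_k -> 'I_n, injective f ->
    \det (map_mx (fun z : int => z%:~R : rat) (colsub f A)) != 0.

Definition entries_bounded (k n : nat) (m : nat) (A : 'M[int]_(k, n)) : Prop :=
  forall i j, `|A i j| <= m%:Z.

(* Main.v *)
Require Import Defs.
From Stdlib Require Import Reals.
From mathcomp Require Import all_boot all_order all_algebra.
From mathcomp Require Import zify ring lra.
Set Implicit Arguments. Unset Strict Implicit. Unset Printing Implicit Defensive.
Import Order.TTheory GRing.Theory Num.Theory.
Local Open Scope ring_scope.

(** The columns are independent copies of a random vector X of Z^k, and it must be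
    shown that k of them are dependent with probability at most (C / L)^k, where L is
    a power of m; a union bound over the k-subsets of columns then concludes.

    X is an iterated difference: start from a uniform vector of {0, .., M-1}^k and
    repeatedly replace a random vector by the difference of two independent copies.
    Each step multiplies P(X in W) by at most 199/200, for every proper subspace W of
    Q^k.  Indeed P(X in W) = r(0), where r, the law of X modulo W, is positive
    definite; if sum r(a)^2 were close to r(0), then almost all the mass of r would
    lie in a set A of near-maximal values, r would still be large on A + A, and
    |A + A| >= 3/2 |A| in a torsion-free group leaves too little mass.  Hence
    P(X in W) <= delta P(Y in W), where Y is the vector after one step and delta is
    a negative power of m.

    As in Kahn, Komlos and Szemeredi, assume that X_1, .., X_r is independent with span
    V.  Most q-tuples of copies of Y lying in V are independent, and the Steinitz lemma
    exchanges them with q of the X_i.  Each exchange trades a factor P(X in V) for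
    P(Y in V), which gains delta^q with q of order k; the number of choices of the
    exchanged X_i is at most 2^k. *)

(** * Energy decay for the law of a difference *)

Lemma coincidence_form_ge0 (T : finType) (G : eqType) (P : T -> G) (w : T -> rat) :
  0 <= \sum_t \sum_t' w t * w t' * (P t == P t')%:R.
Proof.
(* [G] may be infinite, so each fibre of [P] is indexed by a representative [c t] in [T]; the form
   is the sum over fibres of the squared total weights. *)
pose c t := odflt t [pick t' | P t' == P t].
have cP t : P (c t) = P t.
  by rewrite /c; case: pickP => [t' /eqP //|/(_ t)]; rewrite eqxx.
have cE t t' : (P t == P t') = (c t == c t').
  apply/eqP/eqP => [e|e]; last by rewrite -cP e cP.
  rewrite /c -e; case: pickP => [//|/(_ t)]; by rewrite eqxx.
rewrite (partition_big c xpredT) //= sumr_ge0 // => y _.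
rewrite (_ : \sum_(_ | _) _ = (\sum_(t | c t == y) w t) ^+ 2) ?sqr_ge0 //.
rewrite expr2 mulr_suml; apply: eq_bigr => t /eqP ct.
rewrite mulr_sumr [RHS]big_mkcond; apply: eq_bigr => t' _.
by rewrite cE ct eq_sym; case: eqP; rewrite ?mulr1 ?mulr0.
Qed.

Lemma sum_indicator_mem (G : eqType) (s : seq G) (x : G) :
  uniq s -> \sum_(a <- s) (x == a)%:R = (x \in s)%:R :> rat.
Proof.
elim: s => [|a s IH] /=; first by rewrite big_nil.
case/andP => nas us; rewrite big_cons IH // in_cons.
by case: eqP => [->|_] /=; rewrite ?(negPf nas) ?addr0 ?add0r.
Qed.

Lemma sumr_const_seq (T : Type) (s : seq T) (c : rat) :
  \sum_(a <- s) c = (size s)%:R * c.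
Proof. by rewrite big_const_seq count_predT iter_addr_0 mulr_natl. Qed.

Section Energy.

Variables (d : nat) (Om : finType) (Z : Om -> 'rV[rat]_d).

Definition diff_count (a : 'rV[rat]_d) : rat :=
  \sum_w \sum_w' (Z w - Z w' == a)%:R.

Local Notation r := diff_count.
Local Notation n := (#|Om|%:R : rat).

Lemma diff_count_ge0 a : 0 <= r a.
Proof. by do 2!apply: sumr_ge0 => ? _; rewrite ler0n. Qed.

Lemma diff_countN a : r (- a) = r a.
Proof.
rewrite /r exchange_big; apply: eq_bigr => w _; apply: eq_bigr => w' _.
by rewrite -eqr_opp opprB opprK.
Qed.

(** The form counts the coincidences [c i + Z w = c j + Z w'] with weight [al i * al j], so it is a
    coincidence form on [I * Om]. *)
Lemma diff_count_form_ge0 (I : finType) (c : I -> 'rV[rat]_d) (al : I -> rat) :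
  0 <= \sum_i \sum_j al i * al j * r (c j - c i).
Proof.
have := @coincidence_form_ge0 (I * Om)%type _ (fun t => c t.1 + Z t.2) (fun t => al t.1).
congr (_ <= _).
rewrite -(pair_bigA _ (fun i w => \sum_t' al i * al t'.1 * (c i + Z w == c t'.1 + Z t'.2)%:R)) /=.
apply: eq_bigr => i _.
under eq_bigr => w _ do
  rewrite -(pair_bigA _ (fun j w' => al i * al j * (c i + Z w == c j + Z w')%:R)) /=.
rewrite exchange_big; apply: eq_bigr => j _.
rewrite /r mulr_sumr; apply: eq_bigr => w _; rewrite mulr_sumr; apply: eq_bigr => w' _.
by rewrite -subr_eq0 opprD addrACA -[in RHS]subr_eq0 opprB addrC.
Qed.

(** Positive definiteness with weights 1, -1 at the points [a], 0. *)
Lemma diff_count_le0 a : r a <= r 0.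
Proof.
have := @diff_count_form_ge0 bool (fun b => if b then a else 0) (fun b => if b then 1 else -1).
rewrite !big_bool /= !subrr subr0 sub0r diff_countN; lra.
Qed.

(* Positive definiteness with weights 1, -2, 1 at the points a, 0, -b. *)
Lemma diff_countD a b : 2 * r a + 2 * r b - 3 * r 0 <= r (a + b).
Proof.
have := @diff_count_form_ge0 'I_3 (fun i => [tuple a; 0; - b]`_i) (fun i => [tuple 1; -2; 1]`_i).
rewrite !big_ord_recl !big_ord0 /= !subrr !subr0 !sub0r !opprK -opprD !diff_countN (addrC b a); lra.
Qed.

Lemma diff_count0_gt0 : (0 < #|Om|)%N -> 0 < r 0.
Proof.
case/card_gt0P => w _; rewrite /r (bigD1 w) //= (bigD1 w) //= subrr eqxx.
rewrite -addrA ltr_pwDl // addr_ge0 ?sumr_ge0 // => *; rewrite ?ler0n //.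
by apply: sumr_ge0 => *; rewrite ler0n.
Qed.

Lemma sum_diff_count s : uniq s ->
  \sum_(a <- s) r a = \sum_w \sum_w' (Z w - Z w' \in s)%:R.
Proof.
move=> us; rewrite exchange_big; apply: eq_bigr => w _; rewrite exchange_big.
by apply: eq_bigr => w' _; rewrite sum_indicator_mem.
Qed.

Lemma sum_diff_count_le s : uniq s -> \sum_(a <- s) r a <= n ^+ 2.
Proof.
move=> us; rewrite sum_diff_count //.
apply: (@le_trans _ _ (\sum_(w : Om) \sum_(w' : Om) 1)).
  by apply: ler_sum => w _; apply: ler_sum => w' _; rewrite lern1 leq_b1.
by rewrite !sumr_const expr2 mulr_natr lexx.
Qed.

Lemma seq_argmax (T : eqType) (f : T -> rat) (s : seq T) (x : T) : x \in s ->
  exists2 y, y \in s & {in s, forall z, f z <= f y}.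
Proof.
elim: s x => // a s IH x _; case: s IH => [|b s] IH.
  by exists a; rewrite ?mem_head // => z; rewrite inE => /eqP ->.
have [y ys ymax] := IH b (mem_head _ _).
have [le|/ltW le] := leP (f a) (f y).
  exists y; first by rewrite inE ys orbT.
  by move=> z; rewrite inE => /orP[/eqP->|/ymax].
exists a; first exact: mem_head.
move=> z; rewrite inE => /orP[/eqP->//|/ymax /le_trans]; exact.
Qed.

(** The double sum is the sum of the squares of [r]. Bound [r] by [r 0] on the set [A] where it is
    at least 19/20 of [r 0], and by 19/20 of [r 0] elsewhere. If [A] carries at most 9/10 of the
    mass, the ratio is 19/20 + 1/20 * 9/10 = 199/200. *)
Lemma energy_decay : r 0 *+ 2 <= n ^+ 2 ->
  (\sum_w \sum_w' r (Z w - Z w')) *+ 200 <= (n ^+ 2 * r 0) *+ 199.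
Proof.
move=> hr0; have [n0|/card_gt0P[w0 _]] := leqP #|Om| 0.
  have nr_ge0 : 0 <= n ^+ 2 * r 0 by rewrite mulr_ge0 ?diff_count_ge0 ?sqr_ge0.
  rewrite big1 => [|w _]; first by lra.
  by move: n0; rewrite leqn0 => /eqP/card0_eq/(_ w).
have n_gt0 : (0 < #|Om|)%N by apply/card_gt0P; exists w0.
have r0_gt0 := diff_count0_gt0 n_gt0.
have n2_gt0 : 0 < n ^+ 2 by rewrite exprn_gt0 // ltr0n.
pose s := undup [seq Z p.1 - Z p.2 | p <- enum {: Om * Om}].
have in_s w w' : Z w - Z w' \in s.
  by rewrite mem_undup; apply/mapP; exists (w, w'); rewrite ?mem_enum.
pose A := [seq a <- s | r 0 *+ 19 <= r a *+ 20].
have uA : uniq A by rewrite filter_uniq ?undup_uniq.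
have A_r a : a \in A -> r 0 *+ 19 <= r a *+ 20 by rewrite mem_filter => /andP[].
suff mass_small : (\sum_(a <- A) r a) *+ 10 <= (n ^+ 2) *+ 9.
  have : (\sum_w \sum_w' r (Z w - Z w')) *+ 20 <=
      \sum_w \sum_w' (r 0 *+ 19 + r 0 * (Z w - Z w' \in A)%:R).
    rewrite -sumrMnl; apply: ler_sum => w _; rewrite -sumrMnl; apply: ler_sum => w' _.
    rewrite mem_filter in_s andbT; have := diff_count_le0 (Z w - Z w').
    by have [h|h] := leP (r 0 *+ 19) (r (Z w - Z w') *+ 20); [rewrite mulr1|rewrite mulr0]; lra.
  have -> : \sum_w \sum_w' (r 0 *+ 19 + r 0 * (Z w - Z w' \in A)%:R) =
     (n ^+ 2 * r 0) *+ 19 + r 0 * \sum_(a <- A) r a.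
    under eq_bigr => w _ do rewrite big_split -mulr_sumr.
    rewrite big_split -mulr_sumr (sum_diff_count uA); congr (_ + _).
    by rewrite !sumr_const expr2 -mulrA !mulr_natl mulrnAC (mulrnAC _ 19).
  have : r 0 * ((\sum_(a <- A) r a) *+ 10) <= r 0 * (n ^+ 2 *+ 9) by rewrite ler_pM2l.
  lra.
rewrite leNgt; apply/negP => mass.
have mass_le : \sum_(a <- A) r a <= (size A)%:R * r 0.
  by rewrite -sumr_const_seq; apply: ler_sum => a _; apply: diff_count_le0.
have AN a : a \in A -> - a \in A.
  rewrite !mem_filter diff_countN => /andP[-> /=].
  by rewrite mem_undup => /mapP[p _ ->]; rewrite opprB in_s.
(* If [A] were inside {0}, its mass would be at most [r 0], hence at most half of [n ^+ 2] by
   [hr0]. *)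
have [a1 a1A a1_neq0] : exists2 a, a \in A & a != 0.
  apply/hasP; apply/negPn/negP => /hasPn all0.
  have : (size A <= size [:: 0%R : 'rV[rat]_d])%N.
    by apply: uniq_leq_size => // a /all0; rewrite negbK inE.
  move=> /= sA; have : (size A)%:R * r 0 <= r 0 by rewrite ler_piMl ?lern1 // diff_count_ge0.
  lra.
have [i a1i] : exists i, a1 0 i != 0.
  apply/existsP; rewrite -negb_forall; apply: contra a1_neq0 => /forallP h.
  by apply/eqP/rowP => i; rewrite mxE; apply/eqP.
(* Coordinate [i] serves as an ordering of the group; as [A] is symmetric, it takes values between
   [- a0 0 i] and [a0 0 i] there. *)
have [a0 a0A a0max] := seq_argmax (fun a : 'rV_d => a 0 i) a1A.
have a0min a : a \in A -> - a0 0 i <= a 0 i.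
  by move=> /AN/a0max /=; rewrite mxE; lra.
have a0_gt0 : 0 < a0 0 i.
  rewrite lt_neqAle; apply/andP; split; last by have := a0max _ a0A; have := a0min _ a0A; lra.
  apply/eqP => e; move: a1i; have := a0max _ a1A; have := a0min _ a1A; rewrite -e.
  by move=> /= h1 h2 /eqP; apply; lra.
(* [diff_countD] gives the factor 4 * 19/20 - 3 = 8/10. *)
have r_shift a b : a \in A -> b \in A -> r 0 *+ 8 <= r (a + b) *+ 10.
  by move=> /A_r ha /A_r hb; have := diff_countD a b; lra.
(* A + a0 and A - a0 meet only where a coordinate i of A is extremal. *)
have packing (p q : pred 'rV[rat]_d) :
    (forall a b, a \in A -> b \in A -> p a -> q b -> a + a0 != b - a0) ->
    (count p A + count q A)%:R * (r 0 *+ 8) <= n ^+ 2 *+ 10.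
  move=> dis; pose s1 := [seq a + a0 | a <- filter p A]; pose s2 := [seq a - a0 | a <- filter q A].
  have us : uniq (s1 ++ s2).
    rewrite cat_uniq !map_inj_uniq ?filter_uniq ?undup_uniq //; try exact: addIr.
    rewrite andbT /=; apply/hasPn => x /mapP[b]; rewrite mem_filter => /andP[qb bA] ->.
    apply/negP => /mapP[a]; rewrite mem_filter => /andP[pa aA] /esym/eqP.
    by apply/negP/dis.
  apply: (@le_trans _ _ ((\sum_(a <- s1 ++ s2) r a) *+ 10)); last first.
    by rewrite lerMn2r sum_diff_count_le ?orbT.
  rewrite -!size_filter -(size_map (fun a => a + a0)) -[X in (_ + X)%N](size_map (fun a => a - a0)) -size_cat.
  rewrite -sumr_const_seq -[leRHS]sumrMnl big_seq [leRHS]big_seq.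
  apply: ler_sum => x; rewrite mem_cat => /orP[] /mapP[a]; rewrite mem_filter => /andP[_ aA] ->.
    exact: r_shift.
  by apply: r_shift => //; apply: AN.
have h1 := packing (fun=> true) (fun b : 'rV_d => b 0 i != a0 0 i).
have h2 := packing (fun b : 'rV_d => b 0 i != - a0 0 i) (fun=> true).
(* The two extremes differ since [a0 0 i] is positive, so each element of [A] survives in at least
   one of the two thinned copies. *)
have cU : (size A <= count (fun b : 'rV_d => b 0%R i != a0 0%R i) A
    + count (fun b : 'rV_d => b 0%R i != - a0 0%R i) A)%N.
  rewrite -count_predUI; apply: leq_trans (leq_addr _ _).
  rewrite -[leqLHS](count_predT A); apply: sub_count => b _ /=.
  by case: eqP => //= ->; apply/eqP; lra.
have {}h1 : (count xpredT A + count (fun b : 'rV_d => b 0%R i != a0 0%R i) A)%:R * (r 0 *+ 8) <= n ^+ 2 *+ 10.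
  apply: h1 => a b aA bA _ bi; apply/eqP => /rowP/(_ i); rewrite !mxE => e.
  have := a0min _ aA; have := a0max _ bA => /= ? ?; case/eqP: bi; lra.
have {}h2 : (count (fun b : 'rV_d => b 0%R i != - a0 0%R i) A + count xpredT A)%:R * (r 0 *+ 8) <= n ^+ 2 *+ 10.
  apply: h2 => a b aA bA ai _; apply/eqP => /rowP/(_ i); rewrite !mxE => e.
  have := a0min _ aA; have := a0max _ bA => /= ? ?; case/eqP: ai; lra.
(* Adding both packings gives [size A * r 0] at most 5/6 of [n ^+ 2], whereas [mass] and [mass_le]
   make it more than 9/10. *)
have h3 : (3 * size A)%:R * (r 0 *+ 8) <= n ^+ 2 *+ 20.
  apply: le_trans (_ : ((count xpredT A + count (fun b : 'rV_d => b 0%R i != a0 0%R i) A) + (count (fun b : 'rV_d => b 0%R i != - a0 0%R i) A + count xpredT A))%:R * (r 0 *+ 8) <= _); last first.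
    by rewrite natrD mulrDl; lra.
  rewrite ler_wpM2r ?ler_nat ?mulrn_wge0 ?diff_count_ge0 //.
  have -> : count xpredT A = size A by apply: count_predT.
  move: cU; lia.
move: h3; rewrite natrM; lra.
Qed.

End Energy.

(** * Probability of hitting a subspace *)

Section Probability.

Variables (k : nat) (Om : finType) (v : Om -> 'rV[rat]_k).

Definition prob (W : 'M[rat]_k) : rat :=
  #|[set w | (v w <= W)%MS]|%:R / #|Om|%:R.

Definition vdiff (p : Om * Om) : 'rV[rat]_k := v p.1 - v p.2.

(* Odlyzko's bound, for all cosets so that it passes to differences. *)
Definition spread (M : nat) : Prop := forall (W : 'M[rat]_k) (c : 'rV[rat]_k),
  (M ^ (k - \rank W) * #|[set w | ((v w - c)%R <= W)%MS]| <= #|Om|)%N.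

Lemma prob_ge0 W : 0 <= prob W.
Proof. by rewrite divr_ge0 ?ler0n. Qed.

Lemma sum_prob W : (0 < #|Om|)%N ->
  \sum_w (v w <= W)%MS%:R = #|Om|%:R * prob W :> rat.
Proof.
move=> Om0; rewrite /prob mulrC divfK ?pnatr_eq0 -?lt0n //.
rewrite -natr_sum -sum1_card; congr _%:R; rewrite [RHS]big_mkcond /=.
by apply: eq_bigr => w _; rewrite inE; case: (v w <= W)%MS.
Qed.

Lemma prob_eqmx (V W : 'M[rat]_k) : (V :=: W)%MS -> prob V = prob W.
Proof.
move=> e; rewrite /prob; congr (_%:R / _); apply: eq_card => w.
by rewrite !inE e.
Qed.

Lemma prob_spread M W : spread M -> (0 < M)%N ->
  prob W <= (M%:R ^+ (k - \rank W))^-1.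
Proof.
move=> /(_ W 0) + M0; rewrite (eq_card (B := [set w | (v w <= W)%MS])); last first.
  by move=> w; rewrite !inE subr0.
move=> h; rewrite /prob; have [->|Om0] := posnP #|Om|.
  by rewrite invr0 mulr0 invr_ge0 exprn_ge0 ?ler0n.
rewrite ler_pdivrMr ?ltr0n // mulrC ler_pdivlMr ?exprn_gt0 ?ltr0n //.
by rewrite -natrX -natrM ler_nat mulnC.
Qed.

End Probability.

(** With the second copy [b] fixed, the event is that the first copy lies in the coset of [W]
    through [v b + c]. *)
Lemma spread_vdiff k (Om : finType) (v : Om -> 'rV[rat]_k) M :
  spread v M -> spread (vdiff v) M.
Proof.
move=> h W c; rewrite card_prod -sum1_card big_mkcond /=.
rewrite (eq_bigr (fun p => ((v p.1 - v p.2 - c)%R <= W)%MS : nat)); last first.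
  by move=> p _; rewrite inE /vdiff; case: ifP.
rewrite -(pair_bigA _ (fun a b => ((v a - v b - c)%R <= W)%MS : nat)) /=.
rewrite exchange_big big_distrr /= -sum_nat_const.
apply: leq_sum => b _.
have := h W (v b + c); rewrite -[X in (_ * X <= _)%N]sum1_card big_mkcond /=.
congr (_ * _ <= _)%N; apply: eq_bigr => a _.
by rewrite inE opprD addrA; case: ifP.
Qed.

(** Apply [energy_decay] to [Z], the reduction of [v] modulo [W]: up to normalisation, one
    difference hits [W] with probability [r 0], and two successive differences do so with the energy
    of [r]. *)
Lemma prob_vdiff_decay k (Om : finType) (v : Om -> 'rV[rat]_k) W :
  prob (vdiff v) W *+ 2 <= 1 ->
  prob (vdiff (vdiff v)) W *+ 200 <= prob (vdiff v) W *+ 199.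
Proof.
have [Om0|Om0] := posnP #|Om|.
  by rewrite /prob !card_prod Om0 !muln0 invr0 !mulr0 !mul0rn lexx.
have n0 : 0 < (#|Om|%:R : rat) by rewrite ltr0n.
pose Z w := v w *m cokermx W.
have p1 : prob (vdiff v) W * #|Om|%:R ^+ 2 = diff_count Z 0.
  have := @sum_prob k (Om * Om)%type (vdiff v) W; rewrite card_prod muln_gt0 Om0 => /(_ isT).
  rewrite natrM -expr2 mulrC => <-.
  rewrite -(pair_bigA _ (fun a b => (vdiff v (a, b) <= W)%MS%:R)) /=.
  apply: eq_bigr => a _; apply: eq_bigr => b _.
  by rewrite submxE /vdiff /= mulmxBl.
have p2 : prob (vdiff (vdiff v)) W * #|Om|%:R ^+ 4 = \sum_a \sum_b diff_count Z (Z a - Z b).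
  have := @sum_prob k ((Om * Om) * (Om * Om))%type (vdiff (vdiff v)) W.
  rewrite !card_prod !muln_gt0 Om0 => /(_ isT).
  rewrite !natrM -!expr2 -exprM mulrC => <-.
  rewrite -(pair_bigA _ (fun a b => (vdiff (vdiff v) (a, b) <= W)%MS%:R)) /=.
  rewrite exchange_big.
  rewrite -(pair_bigA _ (fun a b => \sum_p (vdiff (vdiff v) (p, (a, b)) <= W)%MS%:R)) /=.
  apply: eq_bigr => a _; apply: eq_bigr => b _.
  rewrite -(pair_bigA _ (fun a' b' => (vdiff (vdiff v) ((a', b'), (a, b)) <= W)%MS%:R)) /=.
  apply: eq_bigr => a' _; apply: eq_bigr => b' _.
  by rewrite submxE /vdiff /= !mulmxBl subr_eq0.
move=> hp; have n2 : 0 < (#|Om|%:R : rat) ^+ 2 by rewrite exprn_gt0.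
have n4 : 0 < (#|Om|%:R : rat) ^+ 4 by rewrite exprn_gt0.
rewrite -(ler_pM2r n4) !mulrnAl p2.
rewrite (_ : prob (vdiff v) W * _ = #|Om|%:R ^+ 2 * diff_count Z 0); last by rewrite -p1; ring.
apply: energy_decay; rewrite -p1 -mulrnAl -[leRHS]mul1r ler_pM2r //.
Qed.

(** * Iterated differences of a uniform grid vector *)

Section Grid.

Variables (M k : nat).

Definition grid_vec (w : {ffun 'I_k -> 'I_M}) : 'rV[int]_k := \row_i (w i : nat)%:Z.

Definition ratvec (u : 'rV[int]_k) : 'rV[rat]_k := map_mx intr u.

(** A basis of [W] has an invertible minor on [\rank W] coordinates. Two points of one coset that
    agree there differ by a vector of [W] vanishing there, hence by 0, so a coset holds at most
    [M ^ \rank W] of the [M ^ k] grid points. *)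
Lemma spread_grid : spread (ratvec \o grid_vec) M.
Proof.
move=> W c; pose r := \rank W; pose R := row_base W.
have rR : row_free R by rewrite /row_free /R eq_row_base.
have fT : row_full R^T by rewrite /row_full mxrank_tr.
have [f fu] : exists f : 'I_r -> 'I_k, rowsub f R^T \in unitmx.
  by exists (fullrankfun fT); apply: fullrowsub_unit.
pose S := [set w | ((ratvec \o grid_vec) w - c <= W)%MS].
have inj : {in S &, injective (fun w : {ffun 'I_k -> 'I_M} => [ffun i => w (f i)] : {ffun 'I_r -> 'I_M})}.
  move=> w1 w2; rewrite !inE => h1 h2 /ffunP e.
  have h : (ratvec (grid_vec w1) - ratvec (grid_vec w2) <= R)%MS.
    rewrite eq_row_base -(subrKA c) -[c - _]opprB -[- (_ - _)]scaleN1r.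
    by rewrite addmx_sub // scalemx_sub.
  case/submxP: h => u hu.
  have u0 : u = 0.
    have : u *m (rowsub f R^T)^T = 0.
      apply/rowP => i; rewrite mxE [RHS]mxE.
      have /rowP/(_ (f i)) := hu; rewrite !mxE.
      have := e i; rewrite !ffunE => ->; rewrite subrr => h0; rewrite [RHS]h0.
      by apply: eq_bigr => j _; rewrite !mxE.
    move/(congr1 (fun x => x *m invmx (rowsub f R^T)^T)).
    by rewrite mulmxK ?unitmx_tr // mul0mx.
  apply/ffunP => i; have /rowP/(_ i) := hu; rewrite u0 mul0mx !mxE.
  by move/eqP; rewrite subr_eq0 eqr_int => /eqP[] /val_inj.
have := card_in_imset inj; rewrite -/S => <-.
rewrite card_ffun !card_ord -[leqRHS](_ : (M ^ (k - r) * M ^ r = _)%N).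
  rewrite leq_mul2l; apply/orP; right.
  by apply: leq_trans (max_card _) _; rewrite card_ffun !card_ord.
by rewrite -expnD subnK ?rank_leq_row.
Qed.

Fixpoint diff_space (j : nat) : finType :=
  if j is j'.+1 then (diff_space j' * diff_space j')%type : finType
  else {ffun 'I_k -> 'I_M}.

Fixpoint diff_vec (j : nat) : diff_space j -> 'rV[int]_k :=
  if j is j'.+1 then fun p => diff_vec p.1 - diff_vec p.2 else grid_vec.

Definition diff_rvec j (w : diff_space j) := ratvec (diff_vec w).

Lemma diff_rvecS j : diff_rvec (j := j.+1) =1 vdiff (diff_rvec (j := j)).
Proof. by move=> p; apply/rowP => i; rewrite !mxE rmorphB. Qed.

Lemma eq_spread (Om : finType) (v v' : Om -> 'rV[rat]_k) N :
  v =1 v' -> spread v N -> spread v' N.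
Proof.
move=> e h W c; have := h W c; congr (_ * _ <= _)%N.
by apply: eq_card => w; rewrite !inE e.
Qed.

Lemma eq_prob (Om : finType) (v v' : Om -> 'rV[rat]_k) W :
  v =1 v' -> prob v W = prob v' W.
Proof.
move=> e; rewrite /prob; congr (_%:R / _).
by apply: eq_card => w; rewrite !inE e.
Qed.

Lemma spread_diff j : spread (diff_rvec (j := j)) M.
Proof.
elim: j => [|j IH]; first exact: spread_grid.
by apply: eq_spread (fsym (diff_rvecS (j := j))) _; apply: spread_vdiff.
Qed.

Lemma card_diff_space_gt0 j : (0 < M)%N -> (0 < #|diff_space j|)%N.
Proof.
move=> M0; elim: j => [|j IH] /=; first by rewrite card_ffun !card_ord expn_gt0 M0.
by rewrite card_prod muln_gt0 IH.
Qed.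

Lemma diff_vec_bound j (w : diff_space j) i : `|diff_vec w 0 i| <= (2 ^ j * M)%:Z.
Proof.
elim: j w => [|j IH] w /=; first by rewrite mxE expn0 mul1n ger0_norm // lez_nat ltnW.
rewrite !mxE expnS -mulnA mul2n -addnn PoszD.
by apply: le_trans (ler_normB _ _) _; rewrite lerD ?IH.
Qed.

(** The decay starts at level 1, whose law is that of a difference and so positive definite. As [W]
    is proper, [spread] bounds its probability by 1/M, at most 1/2. *)
Lemma prob_diff_decay j W : (1 < M)%N -> (\rank W < k)%N ->
  prob (diff_rvec (j := j.+2)) W *+ 200 <= prob (diff_rvec (j := j.+1)) W *+ 199.
Proof.
move=> M1 Wk.
have half : prob (diff_rvec (j := j.+1)) W *+ 2 <= 1.
  rewrite -mulr_natr -ler_pdivlMr ?ltr0n // mul1r.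
  apply: le_trans (prob_spread W (spread_diff j.+1) (ltnW M1)) _.
  rewrite lef_pV2 ?posrE ?exprn_gt0 ?ltr0n ?(ltnW M1) //.
  apply: (@le_trans _ _ M%:R); first by rewrite ler_nat.
  by rewrite -natrX ler_nat -[leqLHS]expn1 leq_pexp2l ?subn_gt0 // ltnW.
have := @prob_vdiff_decay k (diff_space j) (diff_rvec (j := j)) W.
rewrite -(eq_prob W (diff_rvecS (j := j))) => /(_ half).
rewrite (eq_prob W (diff_rvecS (j := j.+1))).
rewrite (_ : prob (vdiff (vdiff _)) W = prob (vdiff (diff_rvec (j := j.+1))) W) //.
by apply: eq_prob => p; rewrite /vdiff !diff_rvecS.
Qed.

End Grid.

(** * Spans of random vectors and Steinitz exchange *)

Lemma rank_adds_row k (v : 'rV[rat]_k) (A : 'M[rat]_k) :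
  \rank (<<v>> + A)%MS = (\rank A + ~~ (v <= A)%MS)%N.
Proof.
have := mxrank_leqif_sup (addsmxSr <<v>>%MS A).
rewrite addsmx_sub genmxE submx_refl andbT => -[le1 e1].
have le2 : (\rank (<<v>> + A)%MS <= \rank A + 1)%N.
  apply: leq_trans (mxrank_adds_leqif _ _).1 _.
  by rewrite addnC leq_add2l genmxE rank_leq_row.
by move: e1; case: (v <= A)%MS => /=; lia.
Qed.

Section Span.

Variables (k : nat) (T Om : finType) (v : Om -> 'rV[rat]_k).

Definition span (X : {ffun T -> Om}) (J : {set T}) : 'M[rat]_k :=
  (\sum_(i in J) <<v (X i)>>)%MS.

Lemma span_subP (X : {ffun T -> Om}) (J : {set T}) (B : 'M[rat]_k) :
  reflect (forall i, i \in J -> (v (X i) <= B)%MS) (span X J <= B)%MS.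
Proof. by apply: (iffP sumsmx_subP) => h i /h; rewrite genmxE. Qed.

Lemma mem_span (X : {ffun T -> Om}) (J : {set T}) i : i \in J -> (v (X i) <= span X J)%MS.
Proof. by move: i; apply/span_subP. Qed.

Lemma spanS X (I J : {set T}) : I \subset J -> (span X I <= span X J)%MS.
Proof. by move=> /subsetP IJ; apply/span_subP => i /IJ; apply: mem_span. Qed.

Lemma span0 X : span X set0 = 0.
Proof. by rewrite /span big_set0. Qed.

Lemma spanU1 (X : {ffun T -> Om}) (J : {set T}) i : i \notin J -> span X (i |: J) = (<<v (X i)>> + span X J)%MS.
Proof. by move=> iJ; rewrite /span big_setU1. Qed.

Lemma rank_span_leq X J : (\rank (span X J) <= #|J|)%N.
Proof.
rewrite -sum1_card; apply: leq_trans (mxrank_sum_leqif _).1 _ => /=.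
by apply: leq_sum => i _; rewrite genmxE rank_leq_row.
Qed.

Lemma eq_span (X X' : {ffun T -> Om}) (J : {set T}) : {in J, X =1 X'} -> span X J = span X' J.
Proof. by move=> e; apply: eq_bigr => i /e ->. Qed.

(** Take [I] largest with [U + span X I] of full rank [\rank U + #|I|]; any vector of the family
    outside this sum could be added to [I]. *)
Lemma steinitz_exchange X J (U : 'M[rat]_k) :
  \rank (span X J) = #|J| -> (U <= span X J)%MS ->
  exists I : {set T}, [/\ I \subset J, (#|I| + \rank U)%N = #|J| &
    (U + span X I :=: span X J)%MS].
Proof.
move=> fJ UJ.
pose P (I : {set T}) := (I \subset J) && (\rank (U + span X I)%MS == \rank U + #|I|)%N.
have P0 : P set0 by rewrite /P sub0set span0 cards0 addn0 addsmx0 eqxx.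
case: (arg_maxnP (fun I : {set T} => #|I|) P0) => I /andP[IJ /eqP rI] maxI.
have sub : (U + span X I <= span X J)%MS by rewrite addsmx_sub UJ spanS.
have sup : (span X J <= U + span X I)%MS.
  apply/span_subP => i iJ; apply: contraLR isT => ni.
  have iI : i \notin I.
    by apply: contra ni => /(mem_span X) /submx_trans; apply; apply: addsmxSr.
  have /maxI : P (i |: I).
    rewrite /P subUset sub1set iJ IJ spanU1 //= cardsU1 iI.
    rewrite (_ : \rank _ = \rank (<<v (X i)>> + (U + span X I))%MS).
      by rewrite rank_adds_row ni rI addn1 add1n addnS.
    by rewrite addsmxA (addsmxC U) -addsmxA.
  by rewrite cardsU1 iI add1n /= ltnn.
exists I; split => //; last by apply/eqmxP; rewrite sub.
have /eqmx_rank := introT andP (conj sub sup).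
by rewrite rI fJ addnC.
Qed.

End Span.

(** * Resampling some coordinates given the others *)

Section Resample.

Variables (T Om : finType) (D : {set T}).
Variables (G : {ffun T -> Om} -> rat) (h : {ffun T -> Om} -> Om -> rat).
Hypothesis Om_gt0 : (0 < #|Om|)%N.
Hypothesis G_indep : forall X X' : {ffun T -> Om}, {in ~: D, X =1 X'} -> G X = G X'.
Hypothesis h_indep : forall X X' : {ffun T -> Om}, {in ~: D, X =1 X'} -> h X = h X'.

(** Conditionally on the coordinates outside [D], those in [D] are independent and uniform, so the
    mean of the product is a power. *)
Lemma sum_resample :
  \sum_X G X * \prod_(i in D) h X (X i) =
  \sum_X G X * ((\sum_w h X w) / #|Om|%:R) ^+ #|D|.
Proof.
have N0 : (#|Om|%:R : rat) != 0 by rewrite pnatr_eq0 -lt0n.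
have NT0 : (#|{ffun T -> Om}|%:R : rat) != 0.
  by rewrite card_ffun pnatr_eq0 -lt0n expn_gt0 Om_gt0.
apply: (mulfI NT0); rewrite !mulr_sumr.
pose m (X Z : {ffun T -> Om}) : {ffun T -> Om} := [ffun i => if i \in D then Z i else X i].
pose F X := G X * \prod_(i in D) h X (X i).
transitivity (\sum_X \sum_(Z : {ffun T -> Om}) F X).
  by apply: eq_bigr => X _; rewrite sumr_const mulr_natl.
rewrite (pair_bigA _ (fun X Z => F X)) /=.
(* Exchanging the [D]-coordinates of [X] with those of an independent [Z] is an involution of the
   pairs, so it preserves the sum. *)
pose s (p : {ffun T -> Om} * {ffun T -> Om}) := (m p.1 p.2, m p.2 p.1).
have sK : involutive s.
  by case=> X Z; congr pair; apply/ffunP => i; rewrite !ffunE; case: (i \in D).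
rewrite (reindex_inj (inv_inj sK)) /=.
rewrite -(pair_bigA _ (fun X Z => F (m X Z))) /=; apply: eq_bigr => X _.
have mX Z : {in ~: D, m X Z =1 X}.
  by move=> i; rewrite inE ffunE => /negPf ->.
rewrite (eq_bigr (fun Z : {ffun T -> Om} => G X * \prod_i (if i \in D then h X (Z i) else 1))).
  rewrite -mulr_sumr -(bigA_distr_bigA (fun i w => if i \in D then h X w else 1)) mulrCA; congr (_ * _).
  rewrite (eq_bigr (fun i => #|Om|%:R * (if i \in D then (\sum_w h X w) / #|Om|%:R else 1))).
    by rewrite big_split /= prodr_const card_ffun natrX -big_mkcond prodr_const.
  by move=> i _; case: ifP => _; rewrite ?mulr1 ?sumr_const // mulrC divfK.
move=> Z _; rewrite /F (G_indep (mX Z)) (h_indep (mX Z)) big_mkcond /=; congr (_ * _).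
by apply: eq_bigr => i _; rewrite ffunE; case: (i \in D).
Qed.

End Resample.

(** * Independent tuples inside a subspace *)

Section Tuples.

Variables (k : nat) (Om : finType) (v : Om -> 'rV[rat]_k).

Fixpoint tuple_space (q : nat) : finType :=
  if q is q'.+1 then (Om * tuple_space q')%type : finType else unit.

Fixpoint tuple_span (q : nat) : tuple_space q -> 'M[rat]_k :=
  if q is q'.+1 then fun y => (<<v y.1>> + tuple_span y.2)%MS else fun=> 0.

Lemma card_tuple_space q : #|tuple_space q| = (#|Om| ^ q)%N.
Proof. by elim: q => [|q IH] /=; rewrite ?card_unit // card_prod IH expnS. Qed.

Lemma rank_tuple_span q (y : tuple_space q) : (\rank (tuple_span y) <= q)%N.
Proof.
elim: q y => [|q IH] y /=; first by rewrite mxrank0.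
by rewrite rank_adds_row; have := IH y.2; case: (_ <= _)%MS => /=; lia.
Qed.

(** The vectors are chosen one by one: given independent ones with span [U] in [V], the next lies in
    [V] but not in [U] with probability at least [prob v V - tau], which is at least half of
    [prob v V]. *)
Lemma many_free_tuples (V : 'M[rat]_k) (tau : rat) q : (0 < #|Om|)%N ->
  (forall W : 'M[rat]_k, (\rank W < q)%N -> prob v W <= tau) -> tau * 2 <= prob v V ->
  (#|Om|%:R * (prob v V / 2)) ^+ q <=
  \sum_(y : tuple_space q) ((tuple_span y <= V)%MS && (\rank (tuple_span y) == q))%:R.
Proof.
move=> Om0; elim: q => [|q IH] small large.
  by rewrite expr0 (bigD1 tt) //= sub0mx mxrank0 eqxx lerDl sumr_ge0 // => *; rewrite ler0n.
rewrite /= -(pair_bigA _ (fun a b => (((<<v a>> + tuple_span b) <= V)%MS &&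
   (\rank (<<v a>> + tuple_span b)%MS == q.+1))%:R)) exchange_big /= exprS.
have {}IH := IH (fun W hW => small W (ltnW hW)) large.
apply: le_trans (ler_wpM2l _ IH) _.
  by rewrite mulr_ge0 ?ler0n ?divr_ge0 ?prob_ge0.
rewrite mulr_sumr; apply: ler_sum => b _.
set U := tuple_span b.
have [/andP[UV /eqP rU]|_] := boolP ((U <= V)%MS && (\rank U == q)); last first.
  by rewrite mulr0 sumr_ge0 // => *; rewrite ler0n.
apply: (@le_trans _ _ (\sum_a ((v a <= V)%MS%:R - (v a <= U)%MS%:R))).
  rewrite sumrB !sum_prob // mulr1 -mulrBr ler_wpM2l ?ler0n //.
  have := small U; rewrite rU ltnSn => /(_ isT) => hU; lra.
apply: ler_sum => a _; rewrite addsmx_sub genmxE UV andbT rank_adds_row rU.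
have [aU|aU] := boolP (v a <= U)%MS.
  by rewrite (submx_trans aU UV) subrr ler0n.
by rewrite addn1 eqxx andbT subr0.
Qed.

End Tuples.

(** * The exchange estimate for one dependent vector *)

Section Swap.

Variables (k : nat) (T OmX OmY : finType).
Variables (vX : OmX -> 'rV[rat]_k) (vY : OmY -> 'rV[rat]_k).
Hypotheses (OmX_gt0 : (0 < #|OmX|)%N) (OmY_gt0 : (0 < #|OmY|)%N).

Local Notation indep X J := (\rank (span vX X J) == #|J|).

Lemma prob_le1 (Om : finType) (v : Om -> 'rV[rat]_k) W : prob v W <= 1.
Proof.
rewrite /prob; have [->|Om0] := posnP #|Om|; first by rewrite invr0 mulr0.
by rewrite ler_pdivrMr ?ltr0n // mul1r ler_nat max_card.
Qed.

Lemma sum_indep_dependent (J : {set T}) i0 : i0 \notin J ->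
  \sum_(X : {ffun T -> OmX}) (indep X J && (vX (X i0) <= span vX X J)%MS)%:R =
  \sum_(X : {ffun T -> OmX}) (indep X J)%:R * prob vX (span vX X J) :> rat.
Proof.
move=> iJ.
have spE (X X' : {ffun T -> OmX}) : {in ~: [set i0], X =1 X'} -> span vX X J = span vX X' J.
  move=> e; apply: eq_span => i iJ'; apply: e; rewrite !inE.
  by apply: contraNneq iJ => <-.
have := @sum_resample T OmX [set i0] (fun X => (indep X J)%:R)
  (fun X w => (vX w <= span vX X J)%MS%:R) OmX_gt0.
have h1 (X X' : {ffun T -> OmX}) (e : {in ~: [set i0], X =1 X'}) : (indep X J)%:R = (indep X' J)%:R :> rat.
  by rewrite (spE _ _ e).
have h2 (X X' : {ffun T -> OmX}) (e : {in ~: [set i0], X =1 X'}) :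
    (fun w => (vX w <= span vX X J)%MS%:R) = (fun w => (vX w <= span vX X' J)%MS%:R) :> (OmX -> rat).
  by rewrite (spE _ _ e).
move=> /(_ h1 h2).
under eq_bigr do rewrite big_set1 -natrM mulnb.
move=> ->; apply: eq_bigr => X _.
by rewrite cards1 expr1 sum_prob // [in LHS]mulrAC divff ?mul1r // pnatr_eq0 -lt0n.
Qed.

(** If the span of the [X i] has [Y]-probability below [tau * 2], comparing [vX] with [vY] gives the
    last term. Otherwise average over free [q]-tuples [y] in the span: each replaces some [q] of the
    [X i], which are then resampled inside a subspace fixed by [y] and the rest. *)
Lemma sum_indep_dependent_le (J : {set T}) i0 (q : nat) (delta tau : rat) :
  i0 \notin J -> (#|J| < k)%N -> (q <= #|J|)%N -> 0 <= delta -> 0 <= tau ->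
  (forall W : 'M[rat]_k, (\rank W < k)%N -> prob vX W <= delta * prob vY W) ->
  (forall W : 'M[rat]_k, (\rank W < q)%N -> prob vY W <= tau) ->
  \sum_(X : {ffun T -> OmX}) (indep X J && (vX (X i0) <= span vX X J)%MS)%:R <=
  #|{ffun T -> OmX}|%:R * (2 ^+ (#|J| + q) * delta ^+ q.+1 + delta * (tau * 2)).
Proof.
move=> iJ Jk qJ d0 t0 hXY small; rewrite sum_indep_dependent //.
have NY0 : 0 < (#|OmY|%:R : rat) by rewrite ltr0n.
pose V (X : {ffun T -> OmX}) (I : {set T}) (y : tuple_space OmY q) := (tuple_span vY y + span vX X I)%MS.
(* The second factor inverts the lower bound of [many_free_tuples], so the sum of [c W] over the
   free tuples in [W] is at least [prob vX W]. *)
pose c (W : 'M[rat]_k) := prob vX W * (#|OmY|%:R * (prob vY W / 2)) ^- q.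
have c_ge0 W : 0 <= c W.
  by rewrite mulr_ge0 ?prob_ge0 // invr_ge0 exprn_ge0 // mulr_ge0 ?ler0n // divr_ge0 ?prob_ge0.
(* [V X I y] does not see the coordinates in [J :\: I], so [sum_resample] applies to the product. *)
pose t (X : {ffun T -> OmX}) (I : {set T}) y := c (V X I y) * \prod_(i in J :\: I) (vX (X i) <= V X I y)%MS%:R.
have t_ge0 X I y : 0 <= t X I y.
  by rewrite mulr_ge0 // prodr_ge0 // => i _; rewrite ler0n.
pose good (I : {set T}) := (I \subset J) && (#|I| + q == #|J|)%N.
have pointwise (X : {ffun T -> OmX}) : (indep X J)%:R * prob vX (span vX X J) <=
    delta * (tau * 2) + \sum_(I | good I) \sum_y t X I y.
  have sum_ge0 : 0 <= \sum_(I | good I) \sum_y t X I y.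
    by apply: sumr_ge0 => I _; apply: sumr_ge0.
  have dt0 : 0 <= delta * (tau * 2) by rewrite !mulr_ge0.
  have [/eqP fJ|_] := boolP (indep X J); last by rewrite mul0r addr_ge0.
  rewrite mul1r; have hXYJ : prob vX (span vX X J) <= delta * prob vY (span vX X J).
    by rewrite hXY // fJ.
  have [lt|le] := ltP (prob vY (span vX X J)) (tau * 2).
    rewrite -[leLHS]addr0; apply: lerD => //; apply: le_trans hXYJ _.
    by rewrite ler_wpM2l // ltW.
  apply: (@le_trans _ _ (\sum_(I | good I) \sum_y t X I y)); last by rewrite lerDr.
  have [p0|p0] := eqVneq (prob vY (span vX X J)) 0.
    by apply: le_trans hXYJ _; rewrite p0 mulr0.
  have pos : 0 < (#|OmY|%:R * (prob vY (span vX X J) / 2)) ^+ q.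
    by rewrite exprn_gt0 // mulr_gt0 // divr_gt0 // lt_neqAle eq_sym p0 prob_ge0.
  have /(ler_wpM2l (c_ge0 (span vX X J))) := many_free_tuples OmY_gt0 small le.
  rewrite {1}/c -mulrA mulVf ?gt_eqF // mulr1 => /le_trans; apply.
  rewrite mulr_sumr exchange_big; apply: ler_sum => y _.
  have [/andP[yJ /eqP ry]|_] := boolP (_ && _); last by rewrite mulr0 sumr_ge0.
  have [I [IJ cI VJ]] := steinitz_exchange fJ yJ.
  rewrite (bigD1 I) /=; last by rewrite /good IJ -cI ry eqxx.
  rewrite mulr1 -[leLHS]addr0 lerD ?sumr_ge0 //.
  rewrite /t /c !(prob_eqmx _ VJ) big1 ?mulr1 // => i.
  by rewrite inE => /andP[_ iJ']; rewrite VJ mem_span.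
have sum_t I y : good I -> \sum_(X : {ffun T -> OmX}) t X I y <=
    #|{ffun T -> OmX}|%:R * (#|OmY|%:R ^- q * (2 ^+ q * delta ^+ q.+1)).
  case/andP => IJ /eqP cI.
  have spE (X X' : {ffun T -> OmX}) : {in ~: (J :\: I), X =1 X'} -> V X I y = V X' I y.
    move=> e; rewrite /V (@eq_span _ _ _ _ X X') // => i iI; apply: e.
    by rewrite !inE iI.
  have h1 (X X' : {ffun T -> OmX}) (e : {in ~: (J :\: I), X =1 X'}) : c (V X I y) = c (V X' I y).
    by rewrite (spE _ _ e).
  have h2 (X X' : {ffun T -> OmX}) (e : {in ~: (J :\: I), X =1 X'}) :
      (fun w => (vX w <= V X I y)%MS%:R) = (fun w => (vX w <= V X' I y)%MS%:R) :> (OmX -> rat).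
    by rewrite (spE _ _ e).
  rewrite (sum_resample OmX_gt0 h1 h2).
  set b := _ ^- q * _; rewrite (_ : _ * b = \sum_(X : {ffun T -> OmX}) b); last first.
    by rewrite sumr_const mulr_natl.
  apply: ler_sum => X _; rewrite {}/b.
  have -> : #|J :\: I| = q by rewrite cardsD (setIidPr IJ) -cI addKn.
  rewrite sum_prob // (mulrAC _ (prob vX (V X I y))) divff ?mul1r ?pnatr_eq0 -?lt0n //.
  have rV : (\rank (V X I y) < k)%N.
    apply: leq_ltn_trans Jk; rewrite -cI addnC.
    apply: leq_trans (mxrank_adds_leqif _ _).1 _.
    by rewrite leq_add ?rank_tuple_span ?rank_span_leq.
  rewrite /c; have := hXY _ rV; have := prob_ge0 vX (V X I y); have := prob_ge0 vY (V X I y).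
  have := prob_le1 vY (V X I y).
  move: (prob vX _) (prob vY _) => a b b1 b0 a0 ab.
  have [b00|bn0] := eqVneq b 0.
    have -> : a = 0 by apply/eqP; rewrite eq_le a0 andbT; rewrite b00 mulr0 in ab.
    by rewrite !mul0r !mulr_ge0 ?invr_ge0 ?exprn_ge0 ?ler0n.
  have bgt0 : 0 < b by rewrite lt_neqAle eq_sym bn0.
  rewrite exprMn exprMn exprVn !invfM invrK.
  (* With a = [prob vX] and b = [prob vY] of the subspace, there are q + 1 factors a against q
     factors 1/b; a <= delta * b leaves one factor b, at most 1. *)
  apply: (@le_trans _ _ (#|OmY|%:R ^- q * (2 ^+ q * ((delta * b) ^+ q.+1 * b ^- q)))).
    rewrite (_ : a * _ * _ = #|OmY|%:R ^- q * (2 ^+ q * (a ^+ q.+1 * b ^- q))); last first.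
      by rewrite exprS; ring.
    do 2!(rewrite ler_wpM2l ?invr_ge0 ?exprn_ge0 ?ler0n //).
    by rewrite ler_wpM2r ?invr_ge0 ?exprn_ge0 // lerXn2r ?nnegrE ?mulr_ge0.
  do 2!(rewrite ler_wpM2l ?invr_ge0 ?exprn_ge0 ?ler0n //).
  by rewrite exprMn -mulrA (exprS b) mulfK ?expf_neq0 // ler_piMr // exprn_ge0.
apply: le_trans (ler_sum _ (fun X _ => pointwise X)) _.
rewrite big_split /= sumr_const [leRHS]mulrDr addrC lerD //; last by rewrite mulr_natl.
rewrite exchange_big /=.
under eq_bigr do rewrite exchange_big /=.
apply: (@le_trans _ _ (\sum_(I | good I) (#|{ffun T -> OmX}|%:R * (2 ^+ q * delta ^+ q.+1)))).
  apply: ler_sum => I gI.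
  apply: le_trans (ler_sum _ (fun y _ => sum_t I y gI)) _.
  rewrite sumr_const (_ : #|_| = (#|OmY| ^ q)%N); last exact: card_tuple_space.
  by rewrite -[leLHS]mulr_natl natrX mulrCA mulVKf // expf_neq0 // gt_eqF.
rewrite sumr_const -[leLHS]mulr_natl mulrCA ler_wpM2l ?ler0n //.
rewrite exprD -mulrA ler_wpM2r ?mulr_ge0 ?exprn_ge0 //.
(* The good sets [I] are among the [2 ^ #|J|] subsets of [J]. *)
rewrite -natrX ler_nat -card_powerset; apply: subset_leq_card.
by apply/subsetP => I; rewrite powersetE => /andP[].
Qed.

End Swap.

(** * Iterating the decay, and a binomial estimate *)

Section Halving.

Variables (N : nat) (f : nat -> rat).
Hypothesis f_ge0 : forall j, 0 <= f j.
Hypothesis f_decay : forall j, f j.+1 *+ N.+1 <= f j *+ N.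

(** Bernoulli's inequality (1 + 1/N)^t >= 1 + t/N in multiplicative form; t = N gives a halving. *)
Lemma decay_linear j t : f (j + t)%N *+ (N + t) <= f j *+ N.
Proof.
elim: t => [|t IH]; first by rewrite !addn0.
apply: le_trans IH; have := f_decay (j + t); rewrite -addnS.
have := f_ge0 (j + t); move: (f (j + t.+1)%N) (f _) => a b b0 h.
have ab : a <= b.
  have : a *+ N.+1 <= b *+ N.+1 by apply: le_trans h _; rewrite mulrSr lerDl.
  by rewrite lerMn2r.
by rewrite (_ : (N + t.+1 = N.+1 + t)%N) ?mulrnDr ?lerD ?lerMn2r ?ab ?orbT // addnS.
Qed.

Lemma decay_pow2 e : (0 < N)%N -> f (N * e)%N * 2 ^+ e <= f 0.
Proof.
move=> N0; elim: e => [|e IH]; first by rewrite muln0 expr0 mulr1.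
apply: le_trans IH; rewrite exprS mulrA ler_wpM2r ?exprn_ge0 // mulnSr.
have := decay_linear (N * e) N; rewrite addnn -mul2n mulrnA lerMn2r.
by rewrite eqn0Ngt N0 /= mulr_natr.
Qed.

End Halving.

Lemma prob_diff_pow2 M k e W : (1 < M)%N -> (\rank W < k)%N ->
  prob (diff_rvec (M := M) (k := k) (j := (199 * e).+1)) W <=
  (2 ^+ e)^-1 * prob (diff_rvec (M := M) (k := k) (j := 1)) W.
Proof.
move=> M1 Wk; rewrite mulrC ler_pdivlMr ?exprn_gt0 //.
exact: (@decay_pow2 199 (fun j => prob (diff_rvec (j := j.+1)) W)
  (fun j => prob_ge0 _ _) (fun j => prob_diff_decay j M1 Wk) e isT).
Qed.

(** Each factor of the falling factorial of [2k] of length [k] is at least [k], so [k ^ k] is at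
    most C(2k, k) k!, hence at most [4 ^ k * k!]. *)
Lemma bin_le_pow n k : ('C(n, k) * k ^ k <= (4 * n) ^ k)%N.
Proof.
have kk : (k ^ k <= 4 ^ k * k`!)%N.
  apply: (@leq_trans ((k.*2) ^_ k)).
    rewrite ffact_prod -[X in (_ ^ X <= _)%N](card_ord k) -prod_nat_const.
    by apply: leq_prod => i _; have := ltn_ord i; lia.
  rewrite -bin_ffact leq_mul2r; apply/orP; right.
  rewrite (_ : 4 ^ k = 2 ^ k.*2)%N; last by rewrite -mul2n expnM.
  rewrite -[2%N]/(1 + 1)%N Pascal.
  have kl : (k < k.*2.+1)%N by lia.
  rewrite (bigD1 (Ordinal kl)) //= !exp1n !muln1; exact: leq_addr.
apply: leq_trans (leq_mul (leqnn _) kk) _.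
rewrite mulnCA expnMn leq_mul2l bin_ffact ffact_prod; apply/orP; right.
rewrite -[X in (_ <= _ ^ X)%N](card_ord k) -prod_nat_const.
by apply: leq_prod => i _; apply: leq_subr.
Qed.

(** * The union bound over sets of columns *)

Section Union.

Variables (k n L : nat) (OmX OmY : finType).
Variables (vX : OmX -> 'rV[rat]_k) (vY : OmY -> 'rV[rat]_k).
Hypotheses (OmX_gt0 : (0 < #|OmX|)%N) (OmY_gt0 : (0 < #|OmY|)%N).
Hypotheses (k_gt0 : (0 < k)%N) (L_gt0 : (0 < L)%N).
Hypotheses (spreadX : spread vX (L ^ 2)) (spreadY : spread vY (L ^ 2)).
Hypothesis prob_XY : forall W : 'M[rat]_k, (\rank W < k)%N ->
  prob vX W <= (L%:R ^+ 2)^-1 * prob vY W.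

Local Notation indep X J := (\rank (span vX X J) == #|J|).

Lemma exprVn_le (a b : nat) : (b <= a)%N -> (L%:R ^+ a)^-1 <= (L%:R ^+ b)^-1 :> rat.
Proof.
move=> ba; rewrite lef_pV2 ?posrE ?exprn_gt0 ?ltr0n //.
by rewrite -!natrX ler_nat leq_pexp2l.
Qed.

(** The exponent 2 in [L ^ 2] is chosen so that codimension at least k/2 already gives L^-k. *)
Lemma spread_le (Om : finType) (v : Om -> 'rV[rat]_k) (W : 'M[rat]_k) (s : nat) :
  spread v (L ^ 2) -> (k <= 2 * (k - s))%N -> (\rank W <= s)%N ->
  prob v W <= (L%:R ^+ k)^-1.
Proof.
move=> sp ks Ws; apply: le_trans (prob_spread W sp _) _; first by rewrite expn_gt0 L_gt0.
by rewrite natrX -exprM exprVn_le //; lia.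
Qed.

(** Small [J] is covered by [spread_le]. Otherwise exchange q = [k./2] vectors with delta = L^-2 and
    tau = L^-k: since 2(q + 1) >= k, the bound is at most (4^k + 2) L^-k. *)
Lemma sum_dependent_pair_le (J : {set 'I_n}) i0 : i0 \notin J -> (#|J| < k)%N ->
  \sum_(X : {ffun 'I_n -> OmX}) (indep X J && (vX (X i0) <= span vX X J)%MS)%:R <=
  #|{ffun 'I_n -> OmX}|%:R * (6 ^+ k / L%:R ^+ k) :> rat.
Proof.
move=> iJ Jk; have Lk0 : 0 < (L%:R : rat) ^+ k by rewrite exprn_gt0 // ltr0n.
have iL0 : 0 <= (L%:R ^+ k)^-1 :> rat by rewrite invr_ge0 ltW.
have [Jq|qJ] := ltnP #|J| k./2.
  rewrite sum_indep_dependent //.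
  apply: (@le_trans _ _ (\sum_(X : {ffun 'I_n -> OmX}) (6 ^+ k / L%:R ^+ k))); last first.
    by rewrite sumr_const mulr_natl.
  apply: ler_sum => X _; apply: (@le_trans _ _ (L%:R ^+ k)^-1).
    apply: (@le_trans _ _ (prob vX (span vX X J))).
      by rewrite ler_piMl ?prob_ge0 // lern1 leq_b1.
    by apply: (spread_le spreadX (s := #|J|)); rewrite ?rank_span_leq //; lia.
  by rewrite ler_peMl // exprn_ege1.
have d0 : 0 <= (L%:R ^+ 2)^-1 :> rat by rewrite invr_ge0 exprn_ge0.
have := @sum_indep_dependent_le k 'I_n OmX OmY vX vY OmX_gt0 OmY_gt0 J i0 k./2
  (L%:R ^+ 2)^-1 (L%:R ^+ k)^-1 iJ Jk qJ d0 iL0 prob_XY.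
have small (W : 'M[rat]_k) : (\rank W < k./2)%N -> prob vY W <= (L%:R ^+ k)^-1.
  by move=> Wq; apply: (spread_le spreadY (s := k./2)); lia.
move=> /(_ small) /le_trans; apply; rewrite ler_wpM2l ?ler0n //.
apply: (@le_trans _ _ ((4 ^+ k + 2) * (L%:R ^+ k)^-1)); last first.
  rewrite ler_wpM2r //; case: (k) k_gt0 => // k' _; elim: k' => [|k' IH]; first by rewrite !expr1.
  rewrite (exprS 6) (exprS 4).
  have : 1 <= (4 : rat) ^+ k'.+1 by rewrite exprn_ege1.
  move: IH; lra.
rewrite mulrDl; apply: lerD.
  apply: ler_pM; rewrite ?exprn_ge0 //.
    rewrite (_ : 4 = 2 ^+ 2) // -exprM ler_weXn2l //; lia.
  by rewrite exprVn -exprM exprVn_le //; lia.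
rewrite [X in _ * X]mulrC ler_piMl ?mulr_ge0 //.
by rewrite invf_le1 ?exprn_gt0 ?ltr0n // exprn_ege1 // ler1n.
Qed.

Lemma dependent_pair (X : {ffun 'I_n -> OmX}) (K : {set 'I_n}) : ~~ indep X K ->
  exists (J : {set 'I_n}) (i : 'I_n),
    [/\ J \subset K, i \in K :\: J & indep X J && (vX (X i) <= span vX X J)%MS].
Proof.
move=> nK; pose P (J : {set 'I_n}) := (J \subset K) && indep X J.
have P0 : P set0 by rewrite /P sub0set span0 mxrank0 cards0 eqxx.
case: (arg_maxnP (fun J : {set 'I_n} => #|J|) P0) => J /andP[JK iJ] maxJ.
have : J \proper K.
  rewrite properEneq JK andbT; by apply: contraNneq nK => <-.
case/properP => _ [i iK niJ]; exists J, i; split; rewrite ?inE ?niJ //.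
rewrite iJ /=; apply: contraLR isT => ni.
have /maxJ : P (i |: J).
  rewrite /P subUset sub1set iK JK spanU1 //= cardsU1 niJ rank_adds_row ni.
  by rewrite (eqP iJ) addn1 add1n.
by rewrite cardsU1 niJ add1n /= ltnn.
Qed.

(** There are C(n, k) sets [K], at most 2^k sets [J] and k <= 2^k indices [i], each event having
    probability at most (6/L)^k. With C(n, k) <= (4n/k)^k the total is at most (96n/(kL))^k < 1. *)
Lemma exists_independent_family : (96 * n < k * L)%N ->
  exists X : {ffun 'I_n -> OmX}, forall K : {set 'I_n}, #|K| = k ->
    \rank (span vX X K) = k.
Proof.
move=> nkL.
case: (pickP (fun X : {ffun 'I_n -> OmX} => [forall K : {set 'I_n}, (#|K| == k) ==> indep X K])).
  move=> X /forallP h; exists X => K cK; have := h K; rewrite cK eqxx => /eqP //.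
move=> bad; exfalso.
pose D (X : {ffun 'I_n -> OmX}) (J : {set 'I_n}) i : rat :=
  (indep X J && (vX (X i) <= span vX X J)%MS)%:R.
have D_ge0 X J i : 0 <= D X J i by rewrite ler0n.
have cover (X : {ffun 'I_n -> OmX}) :
    1 <= \sum_(K : {set 'I_n} | #|K| == k) \sum_(J : {set 'I_n} | J \subset K) \sum_(i in K :\: J) D X J i.
  have /negbT := bad X; rewrite negb_forall => /existsP[K].
  rewrite negb_imply => /andP[cK /dependent_pair[J [i [JK iKJ d]]]].
  rewrite (bigD1 K) //= (bigD1 J) //= (bigD1 i) //= {1}/D d -!addrA lerDl.
  by rewrite !addr_ge0 ?sumr_ge0 // => *; rewrite ?sumr_ge0 // => *; rewrite ?sumr_ge0.
have Lk0 : 0 < (L%:R : rat) ^+ k by rewrite exprn_gt0 // ltr0n.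
pose N : rat := #|{ffun 'I_n -> OmX}|%:R.
have N0 : 0 < N by rewrite ltr0n card_ffun card_ord expn_gt0 OmX_gt0.
have b0 : 0 <= N * (6 ^+ k / L%:R ^+ k) by rewrite mulr_ge0 ?divr_ge0 ?exprn_ge0 ?ler0n.
have total : N <= 'C(n, k)%:R * (4 ^+ k * (N * (6 ^+ k / L%:R ^+ k))).
  apply: (@le_trans _ _ (\sum_(X : {ffun 'I_n -> OmX}) 1)); first by rewrite sumr_const.
  apply: le_trans (ler_sum _ (fun X _ => cover X)) _.
  rewrite exchange_big /=.
  apply: (@le_trans _ _ (\sum_(K : {set 'I_n} | #|K| == k) 4 ^+ k * (N * (6 ^+ k / L%:R ^+ k)))); last first.
    rewrite sumr_const -[leLHS]mulr_natl ler_wpM2r ?mulr_ge0 ?invr_ge0 ?exprn_ge0 ?ler0n //.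
    by rewrite -[in leRHS](card_ord n) -card_draws cardsE.
  apply: ler_sum => K /eqP cK; rewrite exchange_big /=.
  apply: (@le_trans _ _ (\sum_(J : {set 'I_n} | J \subset K) 2 ^+ k * (N * (6 ^+ k / L%:R ^+ k)))); last first.
    rewrite sumr_const -[leLHS]mulr_natl mulrA ler_wpM2r ?b0 //.
    rewrite (_ : #|_| = (2 ^ k)%N); last by rewrite -cK -card_powerset -cardsE; apply: eq_card => J; rewrite !inE.
    by rewrite natrX -exprMn -natrM.
  apply: ler_sum => J JK; rewrite exchange_big /=.
  apply: (@le_trans _ _ (\sum_(i in K :\: J) (N * (6 ^+ k / L%:R ^+ k)))); last first.
    rewrite sumr_const -[leLHS]mulr_natl ler_wpM2r // -natrX ler_nat.
    apply: leq_trans (subset_leq_card (subsetDl _ _)) _; rewrite cK.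
    by rewrite ltnW // ltn_expl.
  apply: ler_sum => i; rewrite inE => /andP[iJ iK]; apply: sum_dependent_pair_le => //.
  by rewrite -cK proper_card //; apply/properP; split => //; exists i.
have : (L ^ k <= 'C(n, k) * 24 ^ k)%N.
  rewrite -[24%N]/(4 * 6)%N expnMn -(ler_nat rat) !natrM !natrX -(ler_pM2l N0).
  have /(ler_wpM2r (ltW Lk0)) := total; congr (_ <= _).
  by rewrite !mulrA divfK ?lt0r_neq0 //; ring.
move=> /(leq_mul (leqnn (k ^ k))); rewrite -expnMn => h.
have : ((k * L) ^ k <= (96 * n) ^ k)%N.
  apply: leq_trans h _; rewrite mulnA (mulnC (k ^ k)%N).
  by rewrite -[96%N]/(4 * 24)%N (mulnAC 4) expnMn leq_mul ?bin_le_pow.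
by rewrite leqNgt ltn_exp2r ?nkL.
Qed.

End Union.

(** * Choice of parameters and conclusion *)

Lemma exists_bounded_MDS (k n L e : nat) :
  (0 < k)%N -> (1 < L)%N -> (L ^ 2 <= 2 ^ e)%N -> (96 * n < k * L)%N ->
  exists A : 'M[int]_(k, n),
    entries_bounded (2 ^ (199 * e).+1 * L ^ 2) A /\ MDS A.
Proof.
move=> k0 L1 Le nkL; have L0 := ltnW L1.
have M1 : (1 < L ^ 2)%N by rewrite -[1%N](expn0 L) ltn_exp2l.
(* From level 1, the law of Y, [199 * e] further differences gain 2^-e, at most L^-2. *)
pose vX := diff_rvec (M := L ^ 2) (k := k) (j := (199 * e).+1).
have card0 j : (0 < #|diff_space (L ^ 2) k j|)%N by rewrite card_diff_space_gt0 // ltnW.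
have prob_XY (W : 'M[rat]_k) : (\rank W < k)%N ->
    prob vX W <= (L%:R ^+ 2)^-1 * prob (diff_rvec (M := L ^ 2) (k := k) (j := 1)) W.
  move=> Wk; apply: le_trans (prob_diff_pow2 e M1 Wk) _.
  rewrite ler_wpM2r ?prob_ge0 // lef_pV2 ?posrE ?exprn_gt0 ?ltr0n //.
  by rewrite -!natrX ler_nat.
have [X indepX] := exists_independent_family (card0 _) (card0 1) k0 L0
  (spread_diff _ _) (spread_diff _ _) prob_XY nkL.
exists (\matrix_(i, j) diff_vec (X j) 0 i); split=> [i j|f f_inj].
  by rewrite mxE diff_vec_bound.
set B := map_mx _ _.
rewrite -unitfE -[_ \is a _]/(B \in unitmx) -unitmx_tr -row_free_unit /row_free.
have cK : #|[set f i | i : 'I_k]| = k by rewrite card_imset // card_ord.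
rewrite eqn_leq rank_leq_row -{1}(indepX _ cK) mxrankS //.
apply/span_subP => _ /imsetP[i _ ->].
rewrite (_ : diff_rvec _ = row i B^T) ?row_sub //.
by apply/rowP => j; rewrite !mxE.
Qed.

Lemma INR_expn a b : INR (a ^ b)%N = pow (INR a) b.
Proof. by elim: b => [|b IH] //; rewrite expnS mult_INR IH. Qed.

Lemma Rpower_bound_nat (c n k m : nat) : (0 < k)%N -> (0 < c)%N -> (k <= n)%N ->
  Rle (Rpower (Rdiv (Rmult (INR c) (INR n)) (INR k)) (INR c)) (INR m) ->
  ((c * (n %/ k)) ^ c <= m)%N.
Proof.
move=> k0 c0 kn.
have kR : Rlt 0 (INR k) by apply: lt_0_INR; apply/ssrnat.ltP.
have cR : Rlt 0 (INR c) by apply: lt_0_INR; apply/ssrnat.ltP.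
have nR : Rlt 0 (INR n) by apply: lt_0_INR; apply/ssrnat.ltP; apply: leq_trans kn.
rewrite Rpower_pow; last by apply: Rdiv_lt_0_compat => //; apply: Rmult_lt_0_compat.
move=> h; apply/ssrnat.leP; apply: INR_le; apply: Rle_trans h.
rewrite INR_expn; apply: pow_incr; split; first exact: pos_INR.
rewrite mult_INR /Rdiv Rmult_assoc; apply: Rmult_le_compat_l; first exact: Rlt_le.
apply: (Rmult_le_reg_r (INR k)) => //.
rewrite Rmult_assoc Rinv_l ?Rmult_1_r; last exact: Rgt_not_eq.
by rewrite -mult_INR; apply: le_INR; apply/ssrnat.leP; apply: leq_trunc_div.
Qed.

Lemma entry_bound_le (N L B e : nat) : (2 * L <= B)%N -> (2 ^ e <= 2 * L ^ 2)%N ->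
  (2 ^ (N * e).+1 * L ^ 2 <= B ^ (2 * N.+1))%N.
Proof.
move=> LB e3; rewrite expnS (mulnC N) expnM mulnAC.
apply: (@leq_trans ((2 * L ^ 2) ^ N.+1)).
  by rewrite (expnS (2 * L ^ 2)%N) leq_mul2l; apply/orP; right; case: (N) => // N'; rewrite leq_exp2r.
rewrite expnM leq_exp2r //; apply: leq_trans (leq_mul LB LB); lia.
Qed.

Theorem theorem2 :
  exists c : R, Rlt 0 c /\
    forall (n k m : nat), (1 <= k)%N -> (k <= n)%N ->
      Rle (Rpower (Rdiv (Rmult c (INR n)) (INR k)) c) (INR m) ->
      exists A : 'M[int]_(k, n), entries_bounded m A /\ MDS A.
Proof.
(* 400 = 2 * (199 + 1) is the exponent in [entry_bound_le]; as a factor it covers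
   [2 * L = 384 * Q]. *)
exists (INR 400); split; first by apply: lt_0_INR; apply/ssrnat.ltP.
move=> n k m k0 kn hm.
(* Since n < k(Q + 1) <= 2kQ, the factor 192 = 2 * 96 gives [96 * n < k * L]. Minimality of [e]
   gives [2 ^ e <= 2 * L ^ 2]. *)
pose Q := (n %/ k)%N; pose L := (192 * Q)%N; pose e := up_log 2 (L ^ 2).
have Q0 : (0 < Q)%N by rewrite divn_gt0.
have L1 : (1 < L)%N by rewrite /L; lia.
have L21 : (1 < L ^ 2)%N by rewrite -[1%N](expn0 L) ltn_exp2l.
have /andP[e1 e2] := up_log_bounds (isT : (1 < 2)%N) L21.
have nkL : (96 * n < k * L)%N.
  by rewrite /L; have := ltn_ceil n k0; rewrite -/Q; nia.
have [A [bA mA]] := exists_bounded_MDS k0 L1 e2 nkL.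
exists A; split => // i j; apply: le_trans (bA i j) _; rewrite lez_nat.
apply: leq_trans (Rpower_bound_nat k0 _ kn hm) => //.
apply: (@entry_bound_le 199); first by rewrite -/Q /L; lia.
have := e1; rewrite -/e; case: (e) => [|e'] /=; first by lia.
by move=> h; rewrite expnS leq_mul2l ltnW.
Qed.
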